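(* For every $u\in W_0^{\overrightarrow s}L_{\overrightarrow\Phi}(Q)$ the following hold: $$\|u\|>1\ \Longrightarrow\ \|u\|^{\varphi^-_{\min}}\le\Psi(u)\le\|u\|^{\varphi^+_{\max}},$$ $$\|u\|<1\ \Longrightarrow\ \|u\|^{\varphi^+_{\max}}\le\Psi(u)\le\|u\|^{\varphi^-_{\min}}.$$
   Context: Let $N\ge1$, $\Omega\subset\mathbb R^N$ a bounded open set, $s_1,\dots,s_N\in(0,1)$, $C\Omega=\mathbb R^N\setminus\Omega$, $Q=\mathbb R^{2N}\setminus(C\Omega\times C\Omega)$. For each $i=1,\dots,N$, $a^i:\mathbb R^N\times\mathbb R^N\times\mathbb R\to\mathbb R$ satisfies $a^i(x,y,t)=a^i(y,x,t)$, and for all $(x,y)$ the function $\varphi^i_{x,y}(t)=a^i(x,y,|t|)t$ for $t\ne0$, $\varphi^i_{x,y}(0)=0$, is an increasing homeomorphism of $\mathbb R$ onto itself. Put $\Phi^i_{x,y}(t)=\int_0^t\varphi^i_{x,y}(\tau)\,d\tau$ for $t\ge0$; $\Phi^i$ is a Musielak function (in particular measurable in $(x,y)$). Assume for each $i$: ($\Phi_1$) there are constants $\varphi_i^\pm$ with $1<\varphi_i^-\le \frac{t\varphi^i_{x,y}(t)}{\Phi^i_{x,y}(t)}\le\varphi_i^+<\infty$ for all $(x,y)$ and $t>0$; ($\Phi_2$) $t\mapsto\Phi^i_{x,y}(\sqrt t)$ is convex on $[0,\infty)$; ($\Phi_3$) $\sup_{(x,y)}\Phi^i_{x,y}(1)<\infty$.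 Set $\varphi^+_{\max}=\max_i\varphi_i^+$, $\varphi^-_{\min}=\min_i\varphi_i^-$. Let $[u]_i=\inf\left\{\lambda>0:\int_Q\Phi^i_{x,y}\left(\frac{|u(x)-u(y)|}{\lambda|x-y|^{s_i}}\right)\frac{dx\,dy}{|x-y|^N}\le1\right\}$. The space $W_0^{\overrightarrow s}L_{\overrightarrow\Phi}(Q)$ is the closure of $C_0^\infty(\Omega)$ (functions extended by $0$ outside $\Omega$) with respect to the norm $\|u\|_{\overrightarrow\Phi}=\sum_{i=1}^N[u]_i$. Put $$\Psi(u)=\sum_{i=1}^N\int_Q\Phi^i_{x,y}\left(\frac{|u(x)-u(y)|}{|x-y|^{s_i}}\right)\frac{dx\,dy}{|x-y|^N},\qquad \|u\|=\inf\{\lambda>0:\Psi(u/\lambda)\le1\}.$$ *)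

(* Defs.v *)
From HB Require Import structures.
From mathcomp Require Import all_boot all_order all_algebra.
From mathcomp Require Import all_classical all_reals all_analysis.

Set Implicit Arguments.
Unset Strict Implicit.
Unset Printing Implicit Defensive.

Import Order.TTheory GRing.Theory Num.Theory.
Import numFieldNormedType.Exports.

Local Open Scope classical_set_scope.
Local Open Scope ring_scope.

(* The coordinate preimages generate the Borel sigma-algebra of R^n. *)
Definition coord_preimages (R : realType) (n : nat) : set (set 'rV[R]_n) :=
  [set A | exists (i : 'I_n) (B : set R),
     measurable B /\ A = (fun x : 'rV[R]_n => x 0 i) @^-1` B].

Definition borelRn (R : realType) (n : nat) : measurableType _ :=
  g_sigma_algebraType (@coord_preimages R n).

Section lebesgueS.
Context (R : realType) (n : nat).

Definition consRn (p : measurableTypeR R * borelRn R n) : borelRn R n.+1 :=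
  row_mx (p.1)%:M (p.2 : 'rV[R]_n) : 'rV[R]_(1 + n).

Lemma consRn0 p : (consRn p : 'rV[R]_n.+1) 0 0 = p.1.
Proof.
have -> : 0 = lshift n 0 :> 'I_(1 + n) by exact/val_inj.
by apply: (etrans (row_mxEl _ _ _ _)); rewrite mxE eqxx mulr1n.
Qed.

Lemma consRnS p (i : 'I_n) :
  (consRn p : 'rV[R]_n.+1) 0 (rshift 1 i) = (p.2 : 'rV[R]_n) 0 i.
Proof. exact: row_mxEr. Qed.

Lemma measurable_consRn : measurable_fun setT consRn.
Proof.
apply: (@measurability _ _ _ (borelRn R n.+1) _ _ (@coord_preimages R n.+1) erefl).
move=> _ [A [i [B [mB ->]]] <-]; rewrite setTI.
have [j ->|j ->] := @split_ordP 1 n i.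
  rewrite (_ : _ @^-1` _ = fst @^-1` B).
    by rewrite -[X in measurable X]setTI; exact: measurable_fst.
  apply/funext => p/=; rewrite /preimage/=.
  by rewrite (_ : lshift n j = 0) ?consRn0//; apply/val_inj; rewrite /= ord1.
rewrite (_ : _ @^-1` _ =
    snd @^-1` ((fun x : 'rV[R]_n => x 0 j) @^-1` B : set (borelRn R n))).
  rewrite -[X in measurable X]setTI; apply: measurable_snd => //.
  by apply: sub_sigma_algebra; exists j, B.
by apply/funext => p; rewrite /preimage/= consRnS.
Qed.

Variable m : {sigma_finite_measure set (borelRn R n) -> \bar R}.

Definition lebesgueS : set (borelRn R n.+1) -> \bar R :=
  pushforward (lebesgue_measure \x m)%E consRn.

Let lebesgueS0 : lebesgueS set0 = 0%E.
Proof. by rewrite /lebesgueS /pushforward preimage_set0 measure0. Qed.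

Let lebesgueS_ge0 A : (0 <= lebesgueS A)%E.
Proof. exact: (measure_ge0 (lebesgue_measure \x m)%E). Qed.

Let measurable_preimage_consRn A :
  measurable A -> measurable (consRn @^-1` A).
Proof.
by move=> mA; rewrite -[X in measurable X]setTI; exact: measurable_consRn.
Qed.

Let lebesgueS_sigma_additive : semi_sigma_additive lebesgueS.
Proof.
move=> F mF tF mUF; rewrite /lebesgueS /pushforward preimage_bigcup.
apply: measure_semi_sigma_additive => [k| |].
- exact: measurable_preimage_consRn.
- apply/trivIsetP => i j _ _ ij; rewrite -preimage_setI.
  by move/trivIsetP : tF => /(_ _ _ _ _ ij) ->//; rewrite preimage_set0.
- by rewrite -preimage_bigcup; exact: measurable_preimage_consRn.
Qed.

HB.instance Definition _ := isMeasure.Build _ _ _ lebesgueS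
  lebesgueS0 lebesgueS_ge0 lebesgueS_sigma_additive.

Let unconsRn (x : borelRn R n.+1) : measurableTypeR R * borelRn R n :=
  ((x : 'rV[R]_n.+1) 0 0, (\row_i (x : 'rV[R]_n.+1) 0 (rshift 1 i) : 'rV[R]_n)).

Let consRnK : cancel consRn unconsRn.
Proof.
move=> [r x]; rewrite /unconsRn consRn0; congr pair.
by apply/rowP => i; rewrite mxE consRnS.
Qed.

Let measurable_unconsRn : measurable_fun setT unconsRn.
Proof.
apply/measurable_fun_pairP; split.
  move=> _ B mB; rewrite setTI; apply: sub_sigma_algebra.
  by exists ord0, B.
apply: (@measurability _ _ _ (borelRn R n) _ _ (@coord_preimages R n) erefl).
move=> _ [A [i [B [mB ->]]] <-]; rewrite setTI.
apply: sub_sigma_algebra; exists (rshift 1 i), B; split => //.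
by apply/funext => x; rewrite /preimage/= mxE.
Qed.

Let lebesgueS_sigma_finite : sigma_finite setT lebesgueS.
Proof.
have /sigma_finiteP[F [FT ndF Foo]] := sigma_finiteT (@lebesgue_measure R).
have /sigma_finiteP[G [GT ndG Goo]] := sigma_finiteT m.
exists (fun k => unconsRn @^-1` (F k `*` G k)).
  rewrite -preimage_bigcup (_ : \bigcup_k _ = setT) ?preimage_setT//.
  rewrite -setXTT FT GT predeqE => -[x y]; split.
    by move=> [n0 _ []/= ? ?]; split; exists n0.
  move=> [/= [i _ Fi] [j _ Gj]]; exists (maxn i j) => //; split.
  - by move: x Fi; exact/subsetPset/ndF/leq_maxl.
  - by move: y Gj; exact/subsetPset/ndG/leq_maxr.
move=> k; have [mF Fk] := Foo k; have [mG Gk] := Goo k; split.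
  rewrite -[X in measurable X]setTI.
  by apply: measurable_unconsRn => //; exact: measurableX.
rewrite /lebesgueS /pushforward -comp_preimage (_ : _ @^-1` _ = F k `*` G k).
  rewrite product_measure1E// lte_mul_pinfty//.
  by rewrite ge0_fin_numE.
apply/funext => p; apply: (congr1 (F k `*` G k)); exact: consRnK.
Qed.

HB.instance Definition _ := Measure_isSigmaFinite.Build _ _ _ lebesgueS
  lebesgueS_sigma_finite.

End lebesgueS.

Fixpoint lebesgueRn (R : realType) (n : nat) :
    {sigma_finite_measure set (borelRn R n) -> \bar R} :=
  match n with
  | 0 => @dirac _ (borelRn R 0) (0 : 'rV[R]_0) R
  | n'.+1 => lebesgueS (lebesgueRn R n')
  end.

Definition box (R : realType) (n : nat) (a b : 'rV[R]_n) : set 'rV[R]_n :=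
  [set x | forall i, a 0 i <= x 0 i <= b 0 i].

Lemma measurable_box (R : realType) (n : nat) (a b : 'rV[R]_n) :
  measurable (box a b : set (borelRn R n)).
Proof.
rewrite (_ : box a b =
    \bigcap_(i in [set: 'I_n]) ((fun x : 'rV[R]_n => x 0 i) @^-1` `[a 0 i, b 0 i])).
  rewrite -[X in measurable X]setCK setC_bigcap.
  apply: measurableC; apply: fin_bigcup_measurable => // i _.
  by apply: measurableC; apply: sub_sigma_algebra; exists i, [set` `[a 0 i, b 0 i]].
apply/seteqP; split => [x abx i _|x abx i] /=.
  by rewrite in_itv/=; exact: abx.
by have := abx i I; rewrite /= in_itv.
Qed.

Lemma lebesgueRn_box (R : realType) (n : nat) (a b : 'rV[R]_n) :
  (forall i, a 0 i <= b 0 i) ->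
  lebesgueRn R n (box a b) = (\prod_(i < n) (b 0 i - a 0 i))%:E.
Proof.
elim: n a b => [a b _|n ih a b ab].
  rewrite big_ord0 /= /dirac indicE mem_set// => -[]//.
pose tl (x : 'rV[R]_n.+1) : 'rV[R]_n := \row_i x 0 (rshift 1 i).
have shiftE i : rshift 1 i = lift ord0 i :> 'I_n.+1 by exact/val_inj.
rewrite /= /lebesgueS /pushforward.
rewrite (_ : _ @^-1` _ = `[a 0 0, b 0 0] `*` box (tl a) (tl b)); last first.
  apply/seteqP; split => [p abp|p [/= p1 p2] i].
    split; first by have := abp ord0; rewrite consRn0/= in_itv.
    by move=> i; have := abp (rshift 1 i); rewrite consRnS !mxE.
  have [j ->|j ->] := @split_ordP 1 n i.
    rewrite (_ : lshift n j = 0); last by apply/val_inj; rewrite /= ord1.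
    by rewrite consRn0; move: p1; rewrite in_itv.
  by rewrite consRnS; have := p2 j; rewrite !mxE.
rewrite product_measure1E//; last exact: measurable_box.
rewrite big_ord_recl EFinM; congr (_ * _)%E.
  apply: (etrans (lebesgue_measure_itv _)); rewrite /= lte_fin.
  case: ltP => // ba.
  by have -> : a 0 0 = b 0 0; [apply/le_anti; rewrite ab|rewrite subrr].
rewrite ih => [|i]; last by rewrite !mxE.
by congr EFin; apply: eq_bigr => i _; rewrite !mxE shiftE.
Qed.

(* Carathéodory extension makes [lebesgueN] and [lebesgue2N] complete: their
   measurable sets are the Lebesgue measurable sets of R^N and R^N x R^N, not
   only the Borel ones. *)
Section lebesgue.
Context (R : realType) (N : nat).

Definition lebesgueN :
    {measure set (caratheodory_type (lebesgueRn R N)^*%mu) -> \bar R} :=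
  @completed_measure_extension _ _ _ (lebesgueRn R N).

Definition lebesgue2N : {measure set (caratheodory_type
    ((lebesgueRn R N \x lebesgueRn R N)%E)^*%mu) -> \bar R} :=
  @completed_measure_extension _ _ _ (lebesgueRn R N \x lebesgueRn R N)%E.

Definition lebesgue_measurable (u : 'rV[R]_N -> R) :=
  measurable_fun [set: caratheodory_type (lebesgueRn R N)^*%mu] u.

Definition lebesgue_measurable2 (f : 'rV[R]_N * 'rV[R]_N -> R) :=
  measurable_fun
    [set: caratheodory_type ((lebesgueRn R N \x lebesgueRn R N)%E)^*%mu] f.

End lebesgue.

(* The norm 'rV[R]_N carries in the library is the sup norm. *)
Definition enorm (R : realType) (N : nat) (x : 'rV[R]_N) : R :=
  Num.sqrt (\sum_(i < N) x 0 i ^+ 2).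

Definition increasing_homeomorphism (R : realType) (f : R -> R) :=
  {homo f : x y / x < y} /\ continuous f /\
  exists g : R -> R, [/\ cancel f g, cancel g f & continuous g].

Section musielak.
Context (R : realType) (N : nat).

Definition phi (a : 'rV[R]_N -> 'rV[R]_N -> R -> R) (x y : 'rV[R]_N) (t : R) :=
  if t == 0 then 0 else a x y `|t| * t.

(* An [Rintegral], used for 0 <= t only; for t < 0 the interval is empty. *)
Definition Phi (a : 'rV[R]_N -> 'rV[R]_N -> R -> R) (x y : 'rV[R]_N) (t : R) :=
  \int[lebesgue_measure]_(tau in `[0, t]) phi a x y tau.

Definition convex_nneg (f : R -> R) :=
  convex_function ([set t | 0 <= t] : set (convex_lmodType R^o)) f.

Definition N_function (f : R -> R) :=
  [/\ convex_nneg f, {within `[0, +oo[, continuous f}, f 0 = 0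
    & forall t, 0 < t -> 0 < f t] /\
  f t / t @[t --> 0^'+] --> 0 /\ f t / t @[t --> +oo] --> +oo.

Definition musielak_function (M : 'rV[R]_N -> 'rV[R]_N -> R -> R) :=
  (forall x y, N_function (M x y)) /\
  forall t, 0 <= t -> lebesgue_measurable2 (fun z => M z.1 z.2 t).

End musielak.

Section space.
Context (R : realType) (N : nat).
Implicit Types (Omega : set 'rV[R]_N) (u : 'rV[R]_N -> R).

(* On the diagonal x = y every integrand below is 0, because [_^-1] and [powR]
   at 0 are 0; the diagonal is a null set. *)
Definition Q Omega : set ('rV[R]_N * 'rV[R]_N) :=
  ~` (~` Omega `*` ~` Omega).

(* Infima are taken in \bar R: the infimum of the empty set is +oo. *)
Definition seminorm Omega (s : R) (a : 'rV[R]_N -> 'rV[R]_N -> R -> R) u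
    : \bar R :=
  ereal_inf [set lam%:E | lam in [set lam : R | 0 < lam /\
    (\int[lebesgue2N R N]_(z in Q Omega)
       (Phi a z.1 z.2
          (`|u z.1 - u z.2| / (lam * enorm (z.1 - z.2)%R `^ s))
        / enorm (z.1 - z.2)%R ^+ N)%:E <= 1)%E]].

Definition normPhi Omega (s : 'I_N -> R)
    (a : 'I_N -> 'rV[R]_N -> 'rV[R]_N -> R -> R) u : \bar R :=
  (\sum_(i < N) seminorm Omega (s i) (a i) u)%E.

Fixpoint Ck (k : nat) u : Prop :=
  continuous u /\
  if k is k'.+1 then
    forall i : 'I_N,
      (forall x, derivable (u : 'rV[R]_N -> R^o) x (delta_mx 0 i)) /\
      Ck k' ('D_(delta_mx 0 i) (u : 'rV[R]_N -> R^o))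
  else True.

(* Functions on Omega extended by 0 are functions on R^N vanishing off Omega. *)
Definition test_function Omega u :=
  [/\ forall k, Ck k u, compact (closure [set x | u x != 0])
    & closure [set x | u x != 0] `<=` Omega].

(* Functions stand for their classes modulo a.e. equality. The closure is taken
   among the measurable functions vanishing a.e. outside Omega: [normPhi] does
   not separate functions differing by a constant. *)
Definition W0 Omega (s : 'I_N -> R)
    (a : 'I_N -> 'rV[R]_N -> 'rV[R]_N -> R -> R) : set ('rV[R]_N -> R) :=
  [set u | [/\ lebesgue_measurable u,
    {ae lebesgueN R N, forall x, ~ Omega x -> u x = 0}
    & forall eps : R, 0 < eps ->
        exists2 v, test_function Omega v &
          (normPhi Omega s a (fun x => u x - v x)%R < eps%:E)%E]].

Definition Psi Omega (s : 'I_N -> R)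
    (a : 'I_N -> 'rV[R]_N -> 'rV[R]_N -> R -> R) u : \bar R :=
  (\sum_(i < N) \int[lebesgue2N R N]_(z in Q Omega)
    (Phi (a i) z.1 z.2 (`|u z.1 - u z.2| / enorm (z.1 - z.2)%R `^ s i)
     / enorm (z.1 - z.2)%R ^+ N)%:E)%E.

Definition luxemburg Omega (s : 'I_N -> R)
    (a : 'I_N -> 'rV[R]_N -> 'rV[R]_N -> R -> R) u : \bar R :=
  ereal_inf [set lam%:E | lam in [set lam : R |
    0 < lam /\ (Psi Omega s a (fun x => u x / lam)%R <= 1)%E]].

End space.

(* Main.v *)
(* The bounds on t phi(t) / Phi(t) say that Phi(t) / t^p is nondecreasing for
   p = phimin and nonincreasing for p = phimax; hence
     c^phimin Psi(w) <= Psi(c w) <= c^phimax Psi(w)   for c >= 1.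
   If lam > ||u|| then Psi(u / lam) <= 1, and if lam < ||u|| then
   Psi(u / lam) > 1; rescaling u / lam to u bounds Psi(u) by a power of lam,
   and letting lam tend to ||u|| gives the claim. *)
Require Import Defs.
From mathcomp Require Import all_boot all_order all_algebra.
From mathcomp Require Import all_classical all_reals all_analysis.
From mathcomp Require Import ring.

Set Implicit Arguments.
Unset Strict Implicit.
Unset Printing Implicit Defensive.

Import Order.TTheory GRing.Theory Num.Theory.
Import numFieldNormedType.Exports.

Local Open Scope classical_set_scope.
Local Open Scope ring_scope.

(** * Growth of a function from bounds on its logarithmic derivative *)

Section growth.
Context (R : realType).
Implicit Types (F f : R -> R) (p c t : R).

(** The derivative of [F t * t^(-p)] is [t^(-p-1) * (t * f t - p * F t)], nonnegative by hypothesis;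
    the mean value theorem concludes. *)
Lemma nondecreasing_mul_powRN F f p :
  (forall t, 0 < t -> is_derive t 1 F (f t)) ->
  (forall t, 0 < t -> p * F t <= t * f t) ->
  forall x y, 0 < x -> x <= y -> F x * x `^ (- p) <= F y * y `^ (- p).
Proof.
move=> dF pF x y x0 xy.
pose dg t := F t *: (- p * t `^ (- p - 1)) + t `^ (- p) *: f t.
have dgE (t : R) : 0 < t -> is_derive t 1 (F * (fun x => x `^ (- p))) (dg t).
  by move=> t0; exact: is_deriveM (dF _ t0) (is_derive1_powR _ t0).
have tgt0 t : t \in `[x, y] -> 0 < t.
  by rewrite in_itv/= => /andP[xt _]; exact: lt_le_trans xt.
have [|c cxy] := MVT_segment xy
    (fun t txy => dgE t (tgt0 _ (subset_itv_oo_cc txy))).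
  by apply: derivable_within_continuous => t /tgt0/dgE[].
have c0 := tgt0 _ cxy.
rewrite -subr_ge0 /= => ->; rewrite mulr_ge0 ?subr_ge0//.
have -> : dg c = c `^ (- p - 1) * (c * f c - p * F c).
  rewrite /dg /GRing.scale/=; have -> : c `^ (- p) = c `^ (- p - 1) * c.
    by rewrite -[X in _ * X]powRr1 ?ltW// -powRD ?subrK// (gt_eqF c0) implybT.
  ring.
by rewrite mulr_ge0 ?powR_ge0// subr_ge0 pF.
Qed.

(** Compares [F t / t^p] at [t] and at [c * t]; the point [t = 0], where no derivative is assumed,
    is settled by [F 0 = 0]. *)
Lemma le_powR_scale F f p : F 0 = 0 ->
  (forall t, 0 < t -> is_derive t 1 F (f t)) ->
  (forall t, 0 < t -> p * F t <= t * f t) ->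
  forall c t, 1 <= c -> 0 <= t -> c `^ p * F t <= F (c * t).
Proof.
move=> F0 dF pF c t c1; rewrite le_eqVlt => /predU1P[<-|t0].
  by rewrite mulr0 F0 mulr0.
have c0 : 0 < c by exact: lt_le_trans c1.
have := nondecreasing_mul_powRN dF pF t0 (ler_peMl (ltW t0) c1).
rewrite (powRM _ (ltW c0) (ltW t0)) mulrA ler_pM2r ?powR_gt0//.
by rewrite powRN ler_pdivlMr ?powR_gt0// mulrC.
Qed.

(** The lower bound puts no sign condition on [F] or [f], so it applies to [- F] and [- f]. *)
Lemma ge_powR_scale F f p : F 0 = 0 ->
  (forall t, 0 < t -> is_derive t 1 F (f t)) ->
  (forall t, 0 < t -> t * f t <= p * F t) ->
  forall c t, 1 <= c -> 0 <= t -> F (c * t) <= c `^ p * F t.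
Proof.
move=> F0 dF pF c t c1 t0.
have dNF (x : R) : 0 < x -> is_derive x 1 (- F) (- f x).
  by move=> /dF dFx; exact: is_deriveN.
have pNF (x : R) : 0 < x -> p * (- F) x <= x * (- f x).
  by move=> /pF; rewrite /= !mulrN lerN2.
have NF0 : (- F) 0 = 0 by rewrite opprfctE F0 oppr0.
by have := le_powR_scale NF0 dNF pNF c1 t0; rewrite /= mulrN lerN2.
Qed.

End growth.

(** * Comparison of integrals *)

Import HBNNSimple.

(* Suprema over simple functions are monotone and homogeneous even when the
   integrands are not measurable. *)
Lemma ge0_le_integralZ d (T : measurableType d) (R : realType)
    (mu : {measure set T -> \bar R}) (D : set T) (f g : T -> \bar R) (k : R) :
  0 < k -> (forall x, D x -> 0 <= f x)%E -> (forall x, D x -> 0 <= g x)%E ->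
  (forall x, D x -> f x <= k%:E * g x)%E ->
  (\int[mu]_(x in D) f x <= k%:E * \int[mu]_(x in D) g x)%E.
Proof.
move=> k0 f0 g0 fg; rewrite !ge0_integralE//.
apply: ge_ereal_sup => _ [h /= hf <-].
have kV0 : 0 <= k^-1 by rewrite invr_ge0 ltW.
rewrite -lee_pdivrMl// -sintegralrM.
apply: ereal_sup_ubound; exists (scale_nnsfun h kV0) => //= x.
rewrite EFinM lee_pdivrMl//; apply: le_trans (hf x) _.
rewrite /patch; case: ifPn => [|_]; last by rewrite mule0.
by rewrite inE => /fg.
Qed.

(** * Passing to the limit in power bounds over the extended reals *)

Section poweR_extremum.
Context (R : realType).
Local Open Scope ereal_scope.

Lemma poweRVK (x : \bar R) (p : R) : (0 < p)%R -> 0 <= x ->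
  (x `^ p^-1) `^ p = x.
Proof. by move=> p0 x0; rewrite -poweRrM mulVf ?gt_eqF// poweRe1. Qed.

Lemma poweRKV (x : \bar R) (p : R) : (0 < p)%R -> 0 <= x ->
  (x `^ p) `^ p^-1 = x.
Proof. by move=> p0 x0; rewrite -poweRrM mulfV ?gt_eqF// poweRe1. Qed.

Lemma poweR_le (x y : \bar R) (p : R) : (0 < p)%R -> 0 <= x -> x <= y ->
  x `^ p <= y `^ p.
Proof.
move=> p0 x0 xy; apply: (gt0_ler_poweR (ltW p0)) => //.
- by rewrite in_itv/= x0 leey.
- by rewrite in_itv/= (le_trans x0 xy) leey.
Qed.

(** Supplies a real scale strictly below a norm that may be [+oo]. *)
Lemma lt_EFin_between (x y : \bar R) : 0 <= x -> x < y ->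
  exists r : R, x < r%:E < y.
Proof.
case: x => [x _||//]; last by case: y.
case: y => [y|_|//].
  by rewrite lte_fin => xy; exists ((x + y) / 2)%R;
    rewrite !lte_fin !(midf_lt xy).
by exists (x + 1)%R; rewrite ltry lte_fin ltrDl ltr01.
Qed.

(** Taking the power [p^-1] turns the hypothesis into a lower bound [P^(1/p)] for [A], hence for its
    infimum, even when [A] is empty. *)
Lemma le_poweR_ereal_inf (A : set R) (P : \bar R) (p : R) :
  (0 < p)%R -> (forall x, A x -> 0 < x)%R -> 0 <= P ->
  (forall x, A x -> P <= (x `^ p)%:E) ->
  P <= ereal_inf [set x%:E | x in A] `^ p.
Proof.
move=> p0 A0 P0 PA; rewrite -[leLHS](poweRVK p0 P0).
apply: poweR_le; rewrite ?poweR_ge0//.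
apply/ereal_infP => _ [x Ax <-].
have x0 : 0 <= x%:E by rewrite lee_fin ltW// A0.
rewrite -[leRHS](poweRKV p0 x0).
by apply: poweR_le; rewrite ?invr_gt0// poweR_EFin PA.
Qed.

(** If [P^(1/p) < L], a real [x] strictly between them and above [b] satisfies [P <= x^p], a
    contradiction. The threshold [b] keeps [x] where the estimate is available: it will be 1 for
    norms above 1 and 0 for norms below 1. *)
Lemma ge_poweR_of_lt (L P : \bar R) (b p : R) :
  (0 < p)%R -> (0 <= b)%R -> b%:E < L -> 0 <= P ->
  (forall x : R, (b < x)%R -> x%:E < L -> (x `^ p)%:E < P) ->
  L `^ p <= P.
Proof.
move=> p0 b0 bL P0 PL.
have L0 : 0 <= L by apply: le_trans (ltW bL); rewrite lee_fin.
rewrite -[leRHS](poweRVK p0 P0); apply: poweR_le => //.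
rewrite leNgt; apply/negP => PltL.
have /lt_EFin_between[|x] : maxe (P `^ p^-1) b%:E < L by rewrite gt_max PltL.
  by rewrite le_max poweR_ge0.
rewrite gt_max => /andP[/andP[Px bx] xL].
suff : P <= (x `^ p)%:E by rewrite leNgt PL// -lte_fin.
rewrite -[leLHS](poweRVK p0 P0) -poweR_EFin.
by apply: poweR_le; rewrite ?poweR_ge0// ltW.
Qed.

End poweR_extremum.

(** * Norm estimates for an abstract modular *)

Section luxemburg_norm.
Context (R : realType) (T : Type) (rho : (T -> R) -> \bar R) (p q : R).
Local Open Scope ereal_scope.
Hypotheses (p0 : (0 < p)%R) (q0 : (0 < q)%R) (rho0 : forall w, 0 <= rho w).
Hypothesis rho_ge : forall (c : R) (w : T -> R), (1 <= c)%R ->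
  (c `^ p)%:E * rho w <= rho (fun x => w x * c)%R.
Hypothesis rho_le : forall (c : R) (w : T -> R), (1 <= c)%R ->
  rho (fun x => w x * c)%R <= (c `^ q)%:E * rho w.
Variable u : T -> R.
Let unit_scales :=
  [set lam : R | (0 < lam)%R /\ rho (fun x => u x / lam)%R <= 1].
Let norm := ereal_inf [set lam%:E | lam in unit_scales].

Let norm_ge0 : 0 <= norm.
Proof. by apply/ereal_infP => _ [x [x0 _] <-]; rewrite lee_fin ltW. Qed.

(** By contraposition: if [rho (u / x) <= 1], then [x] is an admissible scale and bounds the infimum
    [norm] from above. *)
Let rho_gt1 (x : R) : (0 < x)%R -> x%:E < norm -> 1 < rho (fun t => u t / x)%R.
Proof.
move=> x0; rewrite ltNge => xL; rewrite ltNge; apply: contra xL => ux.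
by apply: ereal_inf_lbound; exists x.
Qed.

Let divfK_fun (x : R) : (0 < x)%R -> u = (fun t => u t / x * x)%R.
Proof. by move=> x0; apply/funext => t; rewrite divfK// gt_eqF. Qed.

(** For scales [x < 1] the growth hypotheses apply with [c = x^-1]; this moves the resulting power
    to the other side. *)
Let powRV_cancel (x r : R) (y z : \bar R) : (0 < x)%R ->
  ((x^-1 `^ r)%:E * y <= z) = (y <= (x `^ r)%:E * z).
Proof.
move=> x0; rewrite -lee_pdivrMl ?powR_gt0//; congr (_%:E * _ <= _).
by rewrite -powR_inv1 ?ltW// -powRrM mulN1r powRN.
Qed.

Let powRV_cancel' (x r : R) (y z : \bar R) : (0 < x)%R ->
  (y <= (x^-1 `^ r)%:E * z) = ((x `^ r)%:E * y <= z).
Proof. by move=> x0; rewrite -powRV_cancel ?invr_gt0// invrK. Qed.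

(** The relevant scales are at least 1, so writing [u] as [u / x] times [x] allows [c = x]: below
    the norm [rho (u / x) > 1], at admissible scales [rho (u / x) <= 1]. *)
Lemma luxemburg_gt1 : 1 < norm -> norm `^ p <= rho u <= norm `^ q.
Proof.
move=> L1; apply/andP; split.
  apply: (@ge_poweR_of_lt _ _ _ 1) => // x x1 xL.
  have x0 : (0 < x)%R by exact: lt_trans x1.
  rewrite [in ltRHS](divfK_fun x0); apply: lt_le_trans (rho_ge _ (ltW x1)).
  by rewrite -[ltLHS]mule1 lte_pmul2l ?lte_fin ?powR_gt0// rho_gt1.
apply: le_poweR_ereal_inf => // [x []//|x Sx]; have [x0 ux] := Sx.
have x1 : (1 <= x)%R.
  rewrite -lee_fin; apply: le_trans (ltW L1) _.
  by apply: ereal_inf_lbound; exists x.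
rewrite [in leLHS](divfK_fun x0); apply: le_trans (rho_le _ x1) _.
by rewrite -[leRHS]mule1 lee_pmul2l ?lte_fin ?powR_gt0.
Qed.

(** Scales below 1 force [c = x^-1], passing from [u] to [u / x], so the exponents [p] and [q] trade
    places. *)
Lemma luxemburg_lt1 : norm < 1 -> norm `^ q <= rho u <= norm `^ p.
Proof.
have rho_small (x : R) : (x <= 1)%R -> unit_scales x -> rho u <= (x `^ p)%:E.
  move=> x1 [x0 ux]; have := @rho_ge (x^-1)%R u; rewrite invf_ge1// => /(_ x1).
  rewrite powRV_cancel// => /le_trans; apply.
  by rewrite -[leRHS]mule1 lee_pmul2l ?lte_fin ?powR_gt0.
move=> L1; apply/andP; split.
  (* [ge_poweR_of_lt] with [b = 0] needs a positive norm; for norm 0 the left side is 0 because [q]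
     is nonzero. *)
  have [->|Ln0] := eqVneq norm 0; first by rewrite poweR0r ?gt_eqF.
  apply: (@ge_poweR_of_lt _ _ _ 0) => // [|x x0 xL]; first by rewrite lt0e Ln0.
  have x1 : (x <= 1)%R by rewrite -lee_fin ltW// (lt_trans xL).
  have := @rho_le (x^-1)%R u; rewrite invf_ge1// => /(_ x1).
  rewrite powRV_cancel'//; apply: lt_le_trans.
  by rewrite -[ltLHS]mule1 lte_pmul2l ?lte_fin ?powR_gt0// rho_gt1.
(* Admissible scales above 1 escape [rho_small]; a fixed admissible [y < 1] serves for them, since
   [y^p <= x^p]. *)
have [_ [y Sy <-]] := ereal_inf_lt L1; rewrite lte_fin => y1.
apply: le_poweR_ereal_inf => // [x []//|x Sx].
have [x1|/ltW x1] := leP x 1%R; first exact: rho_small.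
apply: le_trans (rho_small _ (ltW y1) Sy) _.
have y0 : (0 <= y)%R by case: Sy => /ltW.
rewrite lee_fin ge0_ler_powR ?nnegrE// ?(ltW p0)//.
- exact: le_trans x1.
- exact: le_trans (ltW y1) x1.
Qed.

End luxemburg_norm.

(** * Differentiating [Phi] and comparing values of [Psi] *)

Section musielak_modular.
Context (R : realType) (N : nat).

Lemma is_derive_Phi (a : 'rV[R]_N -> 'rV[R]_N -> R -> R) x y (t : R) :
  continuous (phi a x y) -> 0 < t -> is_derive t 1 (Phi a x y) (phi a x y t).
Proof.
move=> ca t0.
(* The right end [t + 1] makes [t] an interior point, where the fundamental theorem of calculus
   applies. *)
have ia : lebesgue_measure.-integrable `[0, t + 1] (EFin \o phi a x y).
  apply: continuous_compact_integrable; first exact: segment_compact.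
  exact: continuous_subspaceT.
have t1 : t < t + 1 by rewrite ltrDl.
have [dP <-] := continuous_FTC1_closed t1 ia t0 (ca t).
by rewrite derive1E; exact: derivableP.
Qed.

(** Here [d] stands for the denominator [enorm (x - y) ^ s i], which may vanish on the diagonal. The
    pointwise bound is integrated, then summed over [i]. *)
Lemma Psi_leZ (Omega : set 'rV[R]_N) (s : 'I_N -> R)
    (a : 'I_N -> 'rV[R]_N -> 'rV[R]_N -> R -> R) (u v : 'rV[R]_N -> R) (k : R) :
  0 < k -> (forall i x y t, 0 <= t -> 0 <= Phi (a i) x y t) ->
  (forall i x y d, 0 <= d ->
    Phi (a i) x y (`|u x - u y| / d) <= k * Phi (a i) x y (`|v x - v y| / d)) ->
  (Psi Omega s a u <= k%:E * Psi Omega s a v)%E.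
Proof.
move=> k0 Phi_ge0 uv.
have integrand_ge0 i w (z : 'rV[R]_N * 'rV[R]_N) :
    (0 <= (Phi (a i) z.1 z.2 (`|w z.1 - w z.2| / enorm (z.1 - z.2)%R `^ s i)
     / enorm (z.1 - z.2)%R ^+ N)%:E)%E.
  rewrite lee_fin mulr_ge0// ?invr_ge0 ?exprn_ge0 ?sqrtr_ge0//.
  by rewrite Phi_ge0// mulr_ge0// invr_ge0 powR_ge0.
rewrite /Psi ge0_sume_distrr => [|i _]; last by apply: integral_ge0 => z _.
apply: lee_sum => i _; apply: ge0_le_integralZ => // z _.
rewrite -EFinM lee_fin mulrA ler_wpM2r ?uv ?powR_ge0//.
by rewrite invr_ge0 exprn_ge0// sqrtr_ge0.
Qed.

End musielak_modular.

(** * The estimates for [Psi] *)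

Theorem proposition3p2 (R : realType) (N : nat) (N_gt0 : (0 < N)%N)
  (Omega : set 'rV[R]_N) (Omega_open : open Omega)
  (Omega_bounded : bounded_set Omega)
  (s : 'I_N -> R) (s01 : forall i, 0 < s i < 1)
  (a : 'I_N -> 'rV[R]_N -> 'rV[R]_N -> R -> R)
  (a_sym : forall i x y t, a i x y t = a i y x t)
  (phi_homeo : forall i x y, increasing_homeomorphism (phi (a i) x y))
  (Phi_musielak : forall i, musielak_function (Phi (a i)))
  (phim phip : 'I_N -> R)
  (Phi1 : forall i, 1 < phim i /\
    forall x y t, 0 < t ->
      phim i <= t * phi (a i) x y t / Phi (a i) x y t <= phip i)
  (Phi2 : forall i x y, convex_nneg (fun t => Phi (a i) x y (Num.sqrt t)))
  (Phi3 : forall i,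
    (ereal_sup [set (Phi (a i) z.1 z.2 1)%:E
                | z in [set: 'rV[R]_N * 'rV[R]_N]] < +oo)%E)
  (phimin := \big[Num.min/phim (Ordinal N_gt0)]_(i < N) phim i)
  (phimax := \big[Num.max/phip (Ordinal N_gt0)]_(i < N) phip i)
  (u : 'rV[R]_N -> R) (Hu : W0 Omega s a u) :
  ((1 < luxemburg Omega s a u)%E ->
     (luxemburg Omega s a u `^ phimin <= Psi Omega s a u
        <= luxemburg Omega s a u `^ phimax)%E) /\
  ((luxemburg Omega s a u < 1)%E ->
     (luxemburg Omega s a u `^ phimax <= Psi Omega s a u
        <= luxemburg Omega s a u `^ phimin)%E).
Proof.
have Phi0 i x y : Phi (a i) x y 0 = 0.
  by have [/(_ x y)[[_ _ ->]]] := Phi_musielak i.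
have Phi_gt0 i x y t : 0 < t -> 0 < Phi (a i) x y t.
  by have [/(_ x y)[[_ _ _]]] := Phi_musielak i; move=> + _ _; apply.
have Phi_ge0 i x y t : 0 <= t -> 0 <= Phi (a i) x y t.
  by rewrite le_eqVlt => /predU1P[<-|/Phi_gt0/ltW//]; rewrite Phi0.
have dPhi i x y (t : R) : 0 < t ->
    is_derive t 1 (Phi (a i) x y) (phi (a i) x y t).
  by apply: is_derive_Phi; have [_ []] := phi_homeo i x y.
have phimin_le i x y t : 0 < t ->
    phimin * Phi (a i) x y t <= t * phi (a i) x y t.
  move=> t0; have [_ /(_ x y t t0)/andP[+ _]] := Phi1 i.
  rewrite ler_pdivlMr ?Phi_gt0//; apply: le_trans.
  by rewrite ler_pM2r ?Phi_gt0// bigmin_le.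
have le_phimax i x y t : 0 < t ->
    t * phi (a i) x y t <= phimax * Phi (a i) x y t.
  move=> t0; have [_ /(_ x y t t0)/andP[_]] := Phi1 i.
  rewrite ler_pdivrMr ?Phi_gt0// => /le_trans; apply.
  by rewrite ler_pM2r ?Phi_gt0// le_bigmax.
have phim_gt0 i : 0 < phim i by have [/(lt_trans ltr01)] := Phi1 i.
have phimin0 : 0 < phimin by rewrite lt_bigmin.
(* Positivity comes from [phim]: evaluating the quotient bound at one point, with [t = 1], gives
   [phim i <= phip i]. *)
have phimax0 : 0 < phimax.
  have [_ /(_ 0 0 1 ltr01)/andP[phim_le le_phip]] := Phi1 (Ordinal N_gt0).
  apply: lt_le_trans (le_bigmax _ _ (Ordinal N_gt0)).
  by apply: lt_le_trans (le_trans phim_le le_phip).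
have Psi_ge0 w : (0 <= Psi Omega s a w)%E.
  apply: sume_ge0 => i _; apply: integral_ge0 => z _.
  rewrite lee_fin mulr_ge0 ?invr_ge0 ?exprn_ge0 ?sqrtr_ge0//.
  by rewrite Phi_ge0// mulr_ge0// invr_ge0 powR_ge0.
have scale_dist c (w : 'rV[R]_N -> R) x y d : 1 <= c ->
    `|w x * c - w y * c| / d = c * (`|w x - w y| / d).
  by move=> c1; rewrite -mulrBl normrM (ger0_norm (le_trans ler01 c1))
    mulrAC mulrC.
have Psi_ge c w : 1 <= c ->
    ((c `^ phimin)%:E * Psi Omega s a w
       <= Psi Omega s a (fun x => w x * c)%R)%E.
  move=> c1; have c0 := lt_le_trans ltr01 c1.
  (* [Psi_leZ] yields upper bounds, so the factor [c^phimin] crosses over as its inverse, the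
     constant [k]. *)
  rewrite -[(_ `^ _)%R]invrK lee_pdivrMl ?invr_gt0 ?powR_gt0//.
  apply: Psi_leZ => //; first by rewrite invr_gt0 powR_gt0.
  move=> i x y d d0; rewrite scale_dist// ler_pdivlMl ?powR_gt0//.
  apply: (le_powR_scale (Phi0 i x y) (dPhi i x y) (phimin_le i x y)) => //.
  exact: divr_ge0.
have Psi_le c w : 1 <= c ->
    (Psi Omega s a (fun x => w x * c)%R
       <= (c `^ phimax)%:E * Psi Omega s a w)%E.
  move=> c1; have c0 := lt_le_trans ltr01 c1.
  apply: Psi_leZ => //; first by rewrite powR_gt0.
  move=> i x y d d0; rewrite scale_dist//.
  apply: (ge_powR_scale (Phi0 i x y) (dPhi i x y) (le_phimax i x y)) => //.
  exact: divr_ge0.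
(* [luxemburg] unfolds to the infimum [norm] of the abstract setting, with [Psi] for [rho], [phimin]
   for [p] and [phimax] for [q]. *)
by split; [exact: luxemburg_gt1|exact: luxemburg_lt1].
Qed.
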